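(* Let $D$ be the first-order $\mathcal{L}_{BT}$-theory with the seven axioms listed in the context, and let $\mathfrak{D}$ be the standard structure of bit strings with concatenation and the prefix relation. For any $\Sigma$-sentence $\phi$, we have $$\mathfrak{D} \models \phi \; \Rightarrow \; D \vdash \phi .$$
   Context: $\mathcal{L}_{BT}$ is the first-order language (with equality) consisting of the constant symbols $e,0,1$, the binary function symbol $\circ$ and one binary relation symbol, written $\sqsubseteq$ in general and written $\preceq$ when working with the structure $\mathfrak{D}$ (it is the same symbol). One writes $st$ for $s\circ t$, and $s \neq t$ for $\neg s=t$. The $\mathcal{L}_{BT}$-structure $\mathfrak{D}$: its universe is the set $\{\boldsymbol{0},\boldsymbol{1}\}^*$ of all finite bit strings, including the empty string $\varepsilon$; $e^{\mathfrak{D}}=\varepsilon$, $0^{\mathfrak{D}}$ is the one-bit string $\boldsymbol{0}$, $1^{\mathfrak{D}}$ is the one-bit string $\boldsymbol{1}$; $\circ^{\mathfrak{D}}$ is concatenation; and $u \preceq^{\mathfrak{D}} v$ iff $u$ is a prefix of $v$, i.e. iff there exists a bit string $x$ with $ux=v$. Bounded quantifiers: $(\exists x\preceq t)\alpha$ abbreviates $(\exists x)[x\preceq t\wedge\alpha]$ and $(\forall x\preceq t)\alpha$ abbreviates $(\forall x)[x\preceq t\rightarrow\alpha]$, where the variable $x$ does not occur in the term $t$. The $\Sigma$-formulas are defined inductively: $\alpha$ and $\neg\alpha$ are $\Sigma$-formulas if $\alpha$ is of the form $s\preceq t$ or $s=t$ for terms $s,t$; $\alpha\vee\beta$ and $\alpha\wedge\beta$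 are $\Sigma$-formulas if $\alpha,\beta$ are; $(\exists x\preceq t)\alpha$, $(\forall x\preceq t)\alpha$ and $(\exists x)\alpha$ are $\Sigma$-formulas if $\alpha$ is. A $\Sigma$-sentence is a $\Sigma$-formula with no free variables. The first-order theory $D$ has the following non-logical axioms: 1. $\forall x[x=ex\wedge x=xe]$; 2. $\forall x y z[(xy)z=x(yz)]$; 3. $\forall x y[x\neq y\to((x0\neq y0)\wedge(x1\neq y1))]$; 4. $\forall x y[x0\neq y1]$; 5. $\forall x[x\preceq e\leftrightarrow x=e]$; 6. $\forall x y[x\preceq y\circ 0\leftrightarrow(x=y\circ 0\vee x\preceq y)]$; 7. $\forall x y[x\preceq y\circ 1\leftrightarrow(x=y\circ 1\vee x\preceq y)]$. $D\vdash\phi$ means that $\phi$ is derivable from the axioms of $D$ in first-order logic with equality. *)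

(* Defs.v *)
From Stdlib Require Import List.
Import ListNotations.

(** * Syntax of L_BT, with de Bruijn indices for variables *)

Inductive term : Type :=
| Var (n : nat)
| Eps
| Zero
| One
| Conc (s t : term).

Inductive form : Type :=
| Eq (s t : term)
| Pre (s t : term)
| Neg (A : form)
| And (A B : form)
| Or (A B : form)
| Imp (A B : form)
| All (A : form)
| Ex (A : form).

Definition Iff (A B : form) : form := And (Imp A B) (Imp B A).

Declare Scope bt_scope.
Delimit Scope bt_scope with bt.
Bind Scope bt_scope with term form.

Infix "∘" := Conc (at level 40, left associativity) : bt_scope.
Infix "≐" := Eq (at level 70) : bt_scope.
Notation "s ≭ t" := (Neg (Eq s t)) (at level 70) : bt_scope.
Infix "⪯" := Pre (at level 70) : bt_scope.
Infix "∧'" := And (at level 80, right associativity) : bt_scope.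
Infix "→'" := Imp (at level 90, right associativity) : bt_scope.
Infix "↔'" := Iff (at level 90) : bt_scope.
Infix "∨'" := Or (at level 85, right associativity) : bt_scope.
Local Open Scope bt_scope.

(** ** Simultaneous capture-avoiding substitution *)

Fixpoint subst_term (sigma : nat -> term) (t : term) : term :=
  match t with
  | Var n => sigma n
  | Eps => Eps
  | Zero => Zero
  | One => One
  | s ∘ u => subst_term sigma s ∘ subst_term sigma u
  end.

Definition shift_term (t : term) : term := subst_term (fun n => Var (S n)) t.

Definition up (sigma : nat -> term) (n : nat) : term :=
  match n with
  | O => Var 0
  | S m => shift_term (sigma m)
  end.

Fixpoint subst (sigma : nat -> term) (A : form) : form :=
  match A with
  | s ≐ t => subst_term sigma s ≐ subst_term sigma t
  | s ⪯ t => subst_term sigma s ⪯ subst_term sigma t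
  | Neg B => Neg (subst sigma B)
  | B ∧' C => subst sigma B ∧' subst sigma C
  | B ∨' C => subst sigma B ∨' subst sigma C
  | B →' C => subst sigma B →' subst sigma C
  | All B => All (subst (up sigma) B)
  | Ex B => Ex (subst (up sigma) B)
  end.

Definition shift (A : form) : form := subst (fun n => Var (S n)) A.

(* Instantiates variable 0 by [t] and lowers the other variables, as needed
   when a quantifier is removed. *)
Definition inst (t : term) (A : form) : form :=
  subst (fun n => match n with O => t | S m => Var m end) A.

(** ** Free variables *)

Fixpoint occurs (k : nat) (t : term) : Prop :=
  match t with
  | Var n => n = k
  | Eps | Zero | One => False
  | s ∘ u => occurs k s \/ occurs k u
  end.

Fixpoint free_in (k : nat) (A : form) : Prop :=
  match A with
  | s ≐ t | s ⪯ t => occurs k s \/ occurs k t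
  | Neg B => free_in k B
  | B ∧' C | B ∨' C | B →' C => free_in k B \/ free_in k C
  | All B | Ex B => free_in (S k) B
  end.

Definition sentence (A : form) : Prop := forall k, ~ free_in k A.

(** ** Bounded quantifiers and Sigma-formulas *)

(* The bound [t] is a term of the outer context; shifting it under the binder
   is what enforces that the quantified variable does not occur in it. *)
Definition BEx (t : term) (A : form) : form := Ex (Var 0 ⪯ shift_term t ∧' A).
Definition BAll (t : term) (A : form) : form := All (Var 0 ⪯ shift_term t →' A).

Inductive Sigma : form -> Prop :=
| Sigma_Eq s t : Sigma (s ≐ t)
| Sigma_Neq s t : Sigma (Neg (s ≐ t))
| Sigma_Pre s t : Sigma (s ⪯ t)
| Sigma_NPre s t : Sigma (Neg (s ⪯ t))
| Sigma_Or A B : Sigma A -> Sigma B -> Sigma (A ∨' B)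
| Sigma_And A B : Sigma A -> Sigma B -> Sigma (A ∧' B)
| Sigma_BEx t A : Sigma A -> Sigma (BEx t A)
| Sigma_BAll t A : Sigma A -> Sigma (BAll t A)
| Sigma_Ex A : Sigma A -> Sigma (Ex A).

Definition Sigma_sentence (A : form) : Prop := Sigma A /\ sentence A.

(** * Semantics *)

Record structure : Type := {
  dom :> Type;
  i_eps : dom;
  i_zero : dom;
  i_one : dom;
  i_conc : dom -> dom -> dom;
  i_pre : dom -> dom -> Prop
}.

Fixpoint eval (M : structure) (rho : nat -> M) (t : term) : M :=
  match t with
  | Var n => rho n
  | Eps => i_eps M
  | Zero => i_zero M
  | One => i_one M
  | s ∘ u => i_conc M (eval M rho s) (eval M rho u)
  end.

Definition scons {X : Type} (x : X) (rho : nat -> X) (n : nat) : X :=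
  match n with
  | O => x
  | S m => rho m
  end.

Fixpoint sat (M : structure) (rho : nat -> M) (A : form) : Prop :=
  match A with
  | s ≐ t => eval M rho s = eval M rho t
  | s ⪯ t => i_pre M (eval M rho s) (eval M rho t)
  | Neg B => ~ sat M rho B
  | B ∧' C => sat M rho B /\ sat M rho C
  | B ∨' C => sat M rho B \/ sat M rho C
  | B →' C => sat M rho B -> sat M rho C
  | All B => forall d : M, sat M (scons d rho) B
  | Ex B => exists d : M, sat M (scons d rho) B
  end.

Definition models (M : structure) (A : form) : Prop :=
  forall rho : nat -> M, sat M rho A.

(* [false] is the bit 0 and [true] the bit 1. *)
Definition bit_strings : structure := {|
  dom := list bool;
  i_eps := [];
  i_zero := [false];
  i_one := [true];
  i_conc := fun u v => u ++ v;
  i_pre := fun u v => exists x, u ++ x = v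
|}.

(** * Classical natural deduction with equality *)

Inductive nd : list form -> form -> Prop :=
| nd_ax Γ A : In A Γ -> nd Γ A
| nd_NegI Γ A B : nd (A :: Γ) B -> nd (A :: Γ) (Neg B) -> nd Γ (Neg A)
| nd_NegE Γ A B : nd Γ A -> nd Γ (Neg A) -> nd Γ B
| nd_DN Γ A : nd Γ (Neg (Neg A)) -> nd Γ A
| nd_AndI Γ A B : nd Γ A -> nd Γ B -> nd Γ (A ∧' B)
| nd_AndE1 Γ A B : nd Γ (A ∧' B) -> nd Γ A
| nd_AndE2 Γ A B : nd Γ (A ∧' B) -> nd Γ B
| nd_OrI1 Γ A B : nd Γ A -> nd Γ (A ∨' B)
| nd_OrI2 Γ A B : nd Γ B -> nd Γ (A ∨' B)
| nd_OrE Γ A B C :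
    nd Γ (A ∨' B) -> nd (A :: Γ) C -> nd (B :: Γ) C -> nd Γ C
| nd_ImpI Γ A B : nd (A :: Γ) B -> nd Γ (A →' B)
| nd_ImpE Γ A B : nd Γ (A →' B) -> nd Γ A -> nd Γ B
| nd_AllI Γ A : nd (map shift Γ) A -> nd Γ (All A)
| nd_AllE Γ A t : nd Γ (All A) -> nd Γ (inst t A)
| nd_ExI Γ A t : nd Γ (inst t A) -> nd Γ (Ex A)
| nd_ExE Γ A C : nd Γ (Ex A) -> nd (A :: map shift Γ) (shift C) -> nd Γ C
| nd_refl Γ t : nd Γ (t ≐ t)
| nd_subst Γ A s t : nd Γ (s ≐ t) -> nd Γ (inst s A) -> nd Γ (inst t A).

Definition theory : Type := form -> Prop.

Definition proves (T : theory) (A : form) : Prop :=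
  exists Γ : list form, (forall B, In B Γ -> T B) /\ nd Γ A.

(** * The theory D *)

(* Two leading quantifiers read "for all x, y" make x = [Var 1], y = [Var 0];
   three make x = [Var 2], y = [Var 1], z = [Var 0]. *)
Definition D_axioms : list form := [
  All (Var 0 ≐ Eps ∘ Var 0 ∧' Var 0 ≐ Var 0 ∘ Eps);
  All (All (All ((Var 2 ∘ Var 1) ∘ Var 0 ≐ Var 2 ∘ (Var 1 ∘ Var 0))));
  All (All (Var 1 ≭ Var 0 →'
    (Var 1 ∘ Zero ≭ Var 0 ∘ Zero ∧' Var 1 ∘ One ≭ Var 0 ∘ One)));
  All (All (Var 1 ∘ Zero ≭ Var 0 ∘ One));
  All (Var 0 ⪯ Eps ↔' Var 0 ≐ Eps);
  All (All (Var 1 ⪯ Var 0 ∘ Zero ↔'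
    (Var 1 ≐ Var 0 ∘ Zero ∨' Var 1 ⪯ Var 0)));
  All (All (Var 1 ⪯ Var 0 ∘ One ↔'
    (Var 1 ≐ Var 0 ∘ One ∨' Var 1 ⪯ Var 0)))
].

Definition D : theory := fun A => In A D_axioms.

(* Main.v *)
Require Import Defs.
From Stdlib Require Import List Bool.
Import ListNotations.
Local Open Scope bt_scope.

(** The proof assigns to each bit string a closed term denoting it, its
    numeral, and shows that [D] decides the atomic facts about numerals: it
    computes concatenations ([numeral_conc]), refutes the equality of distinct
    numerals ([numeral_neq]), and knows the finitely many prefixes of a numeral
    ([numeral_pre_intro], [numeral_pre_elim]).  Every [Sigma]-formula that is
    true under an assignment of strings is then derivable once its variables
    are replaced by the numerals of their values ([Sigma_complete]), by
    induction on the formula.  A true existential is proved by the numeral of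
    a witness.  A bounded universal quantifier over the prefixes of [t] becomes
    a finite case distinction, since [D] proves that a prefix of a numeral is
    one of finitely many numerals.  The substitution leaves a sentence
    unchanged, which gives the theorem.

    The axioms do not say that [x0] and [x1] differ from [e].  For a numeral
    [x] this follows from [x ⪯ x]: if [xb = e] then [x ⪯ xb] gives [x ⪯ e],
    so [x = e] and hence [b = e]; for the other bit [c], the term [c b] then
    equals both [c] and [e c], and these cannot end in different bits. *)

(** * Substitution *)

Lemma subst_term_ext (sigma tau : nat -> term) (t : term) :
  (forall n, sigma n = tau n) -> subst_term sigma t = subst_term tau t.
Proof. intros H; induction t; simpl; congruence. Qed.

Lemma up_ext (sigma tau : nat -> term) :
  (forall n, sigma n = tau n) -> forall n, up sigma n = up tau n.
Proof. intros H [|n]; simpl; congruence. Qed.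

Lemma subst_ext (A : form) : forall sigma tau : nat -> term,
  (forall n, sigma n = tau n) -> subst sigma A = subst tau A.
Proof.
  induction A; intros sigma tau H; simpl; f_equal;
    auto using subst_term_ext, up_ext.
Qed.

Lemma subst_term_comp (sigma tau : nat -> term) (t : term) :
  subst_term tau (subst_term sigma t)
  = subst_term (fun n => subst_term tau (sigma n)) t.
Proof. induction t; simpl; congruence. Qed.

Lemma subst_comp (A : form) : forall sigma tau : nat -> term,
  subst tau (subst sigma A) = subst (fun n => subst_term tau (sigma n)) A.
Proof.
  assert (Hup : forall (sigma tau : nat -> term) n,
    subst_term (up tau) (up sigma n) = up (fun m => subst_term tau (sigma m)) n).
  { intros sigma tau [|n]; simpl; [reflexivity|].
    unfold shift_term; rewrite !subst_term_comp. reflexivity. }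
  induction A; intros sigma tau; simpl; f_equal; auto using subst_term_comp;
    rewrite IHA; apply subst_ext; auto.
Qed.

Lemma subst_term_free_id (sigma : nat -> term) (t : term) :
  (forall k, occurs k t -> sigma k = Var k) -> subst_term sigma t = t.
Proof. induction t; simpl; intros H; f_equal; auto. Qed.

Lemma subst_free_id (A : form) : forall sigma : nat -> term,
  (forall k, free_in k A -> sigma k = Var k) -> subst sigma A = A.
Proof.
  induction A; simpl; intros sigma H; f_equal;
    auto using subst_term_free_id;
    apply IHA; intros [|k] Hk; simpl; trivial; now rewrite H.
Qed.

Lemma subst_term_Var (t : term) : subst_term Var t = t.
Proof. now apply subst_term_free_id. Qed.

Lemma inst_shift_term (t u : term) :
  subst_term (fun n => match n with O => u | S m => Var m end) (shift_term t) = t.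
Proof. unfold shift_term; rewrite subst_term_comp; apply subst_term_Var. Qed.

(** * Derived rules *)

Lemma nd_weaken (Gamma : list form) (A : form) :
  nd Gamma A -> forall Delta, incl Gamma Delta -> nd Delta A.
Proof.
  assert (Hcons : forall (G G' : list form) B, incl G G' -> incl (B :: G) (B :: G')).
  { intros G G' B H; apply incl_cons; [now left | now apply incl_tl]. }
  induction 1; intros Delta HD;
    [ apply nd_ax | eapply nd_NegI | eapply nd_NegE | apply nd_DN
    | apply nd_AndI | eapply nd_AndE1 | eapply nd_AndE2
    | apply nd_OrI1 | apply nd_OrI2 | eapply nd_OrE
    | apply nd_ImpI | eapply nd_ImpE | apply nd_AllI | apply nd_AllE
    | eapply nd_ExI | eapply nd_ExE | apply nd_refl | eapply nd_subst ];
    eauto using incl_map.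
Qed.

Lemma nd_weaken1 (Gamma : list form) (A B : form) :
  nd Gamma A -> nd (B :: Gamma) A.
Proof. intros H; apply (nd_weaken _ _ H), incl_tl, incl_refl. Qed.

Lemma nd_hyp (Gamma : list form) (A : form) : nd (A :: Gamma) A.
Proof. apply nd_ax; now left. Qed.

Lemma nd_modus_tollens (Gamma : list form) (A B : form) :
  nd (A :: Gamma) B -> nd Gamma (Neg B) -> nd Gamma (Neg A).
Proof. intros H1 H2; eapply nd_NegI; [exact H1 | now apply nd_weaken1]. Qed.

Lemma nd_eq_sym (Gamma : list form) (s t : term) :
  nd Gamma (s ≐ t) -> nd Gamma (t ≐ s).
Proof.
  intros H. pose proof (nd_subst Gamma (Var 0 ≐ shift_term s) s t H) as K.
  cbn in K; rewrite !inst_shift_term in K. apply K, nd_refl.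
Qed.

Lemma nd_eq_trans (Gamma : list form) (s t u : term) :
  nd Gamma (s ≐ t) -> nd Gamma (t ≐ u) -> nd Gamma (s ≐ u).
Proof.
  intros H1 H2. pose proof (nd_subst Gamma (shift_term s ≐ Var 0) t u H2) as K.
  cbn in K; rewrite !inst_shift_term in K. now apply K.
Qed.

Lemma nd_conc_cong (Gamma : list form) (s s' t t' : term) :
  nd Gamma (s ≐ s') -> nd Gamma (t ≐ t') -> nd Gamma (s ∘ t ≐ s' ∘ t').
Proof.
  intros H1 H2. apply nd_eq_trans with (s' ∘ t).
  - pose proof (nd_subst Gamma
      (shift_term (s ∘ t) ≐ Var 0 ∘ shift_term t) s s' H1) as K.
    unfold inst in K; cbn [subst] in K; rewrite inst_shift_term in K.
    cbn in K; rewrite !inst_shift_term in K. apply K, nd_refl.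
  - pose proof (nd_subst Gamma
      (shift_term (s' ∘ t) ≐ shift_term s' ∘ Var 0) t t' H2) as K.
    unfold inst in K; cbn [subst] in K; rewrite inst_shift_term in K.
    cbn in K; rewrite !inst_shift_term in K. apply K, nd_refl.
Qed.

Lemma nd_pre_cong (Gamma : list form) (s s' t t' : term) :
  nd Gamma (s ≐ s') -> nd Gamma (t ≐ t') -> nd Gamma (s ⪯ t) ->
  nd Gamma (s' ⪯ t').
Proof.
  intros H1 H2 H.
  assert (H' : nd Gamma (s' ⪯ t)).
  { pose proof (nd_subst Gamma (Var 0 ⪯ shift_term t) s s' H1) as K.
    cbn in K; rewrite !inst_shift_term in K. now apply K. }
  pose proof (nd_subst Gamma (shift_term s' ⪯ Var 0) t t' H2) as K.
  cbn in K; rewrite !inst_shift_term in K. now apply K.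
Qed.

(** * Instances of the axioms *)

Definition bit (b : bool) : term := if b then One else Zero.

Section Instances.

Context (Gamma : list form) (HD : incl D_axioms Gamma).

Lemma D_axiom (n : nat) (A : form) : nth_error D_axioms n = Some A -> nd Gamma A.
Proof. intros H; apply nd_ax, HD; now apply nth_error_In with n. Qed.

Lemma D_unit (x : term) : nd Gamma (x ≐ Eps ∘ x ∧' x ≐ x ∘ Eps).
Proof. exact (nd_AllE _ _ x (D_axiom 0 _ eq_refl)). Qed.

Lemma D_unit_l (x : term) : nd Gamma (x ≐ Eps ∘ x).
Proof. eapply nd_AndE1, D_unit. Qed.

Lemma D_unit_r (x : term) : nd Gamma (x ≐ x ∘ Eps).
Proof. eapply nd_AndE2, D_unit. Qed.

Lemma D_assoc (x y z : term) : nd Gamma ((x ∘ y) ∘ z ≐ x ∘ (y ∘ z)).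
Proof.
  pose proof (nd_AllE _ _ z (nd_AllE _ _ y (nd_AllE _ _ x
    (D_axiom 1 _ eq_refl)))) as K.
  cbn in K; rewrite inst_shift_term in K.
  (* [x] passes under two binders, hence is shifted twice *)
  unfold shift_term in K; rewrite !subst_term_comp in K; cbn in K.
  rewrite subst_term_Var in K. exact K.
Qed.

Lemma D_snoc_inj (x y : term) (b : bool) :
  nd Gamma (x ≭ y) -> nd Gamma (x ∘ bit b ≭ y ∘ bit b).
Proof.
  intros H. pose proof (nd_AllE _ _ y (nd_AllE _ _ x
    (D_axiom 2 _ eq_refl))) as K.
  cbn in K; rewrite inst_shift_term in K.
  pose proof (nd_ImpE _ _ _ K H) as K'.
  destruct b; [eapply nd_AndE2 | eapply nd_AndE1]; exact K'.
Qed.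

Lemma D_last_bit (x y : term) (b : bool) :
  nd Gamma (x ∘ bit b ≭ y ∘ bit (negb b)).
Proof.
  assert (K : forall s t, nd Gamma (s ∘ Zero ≭ t ∘ One)).
  { intros s t. pose proof (nd_AllE _ _ t (nd_AllE _ _ s
      (D_axiom 3 _ eq_refl))) as K.
    cbn in K; rewrite inst_shift_term in K. exact K. }
  destruct b; [|apply K].
  eapply nd_modus_tollens; [apply nd_eq_sym, nd_hyp | apply K].
Qed.

Lemma D_pre_eps (x : term) : nd Gamma (x ⪯ Eps ↔' x ≐ Eps).
Proof. exact (nd_AllE _ _ x (D_axiom 4 _ eq_refl)). Qed.

Lemma D_pre_snoc (x y : term) (b : bool) :
  nd Gamma (x ⪯ y ∘ bit b ↔' (x ≐ y ∘ bit b ∨' x ⪯ y)).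
Proof.
  assert (K : nd Gamma (All (All (Var 1 ⪯ Var 0 ∘ bit b ↔'
    (Var 1 ≐ Var 0 ∘ bit b ∨' Var 1 ⪯ Var 0))))).
  { destruct b; [apply (D_axiom 6) | apply (D_axiom 5)]; reflexivity. }
  apply nd_AllE with (t := x) in K; apply nd_AllE with (t := y) in K.
  destruct b; cbn in K; rewrite inst_shift_term in K; exact K.
Qed.

End Instances.

(** * Numerals *)

(** The bits are listed last bit first, because the axioms about equality and
    prefixes take a string apart at its right end. *)
Fixpoint rev_numeral (l : list bool) : term :=
  match l with
  | [] => Eps
  | b :: l' => rev_numeral l' ∘ bit b
  end.

Definition numeral (w : list bool) : term := rev_numeral (rev w).

Lemma subst_rev_numeral (sigma : nat -> term) (l : list bool) :
  subst_term sigma (rev_numeral l) = rev_numeral l.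
Proof. induction l as [|[] l IH]; simpl; congruence. Qed.

Section Numerals.

Context (Gamma : list form) (HD : incl D_axioms Gamma).

Lemma rev_numeral_conc (k l : list bool) :
  nd Gamma (rev_numeral k ∘ rev_numeral l ≐ rev_numeral (l ++ k)).
Proof.
  induction l as [|b l IH]; simpl.
  - now apply nd_eq_sym, D_unit_r.
  - eapply nd_eq_trans; [now apply nd_eq_sym, D_assoc |].
    apply nd_conc_cong; [exact IH | apply nd_refl].
Qed.

Lemma numeral_conc (u v : list bool) :
  nd Gamma (numeral u ∘ numeral v ≐ numeral (u ++ v)).
Proof. unfold numeral; rewrite rev_app_distr; apply rev_numeral_conc. Qed.

Lemma rev_numeral_pre_intro (k l : list bool) :
  nd Gamma (rev_numeral l ⪯ rev_numeral (k ++ l)).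
Proof.
  induction k as [|b k IH]; simpl.
  - destruct l as [|b l]; simpl.
    + eapply nd_ImpE; [eapply nd_AndE2; now apply D_pre_eps | apply nd_refl].
    + eapply nd_ImpE; [eapply nd_AndE2; now apply D_pre_snoc |].
      apply nd_OrI1, nd_refl.
  - eapply nd_ImpE; [eapply nd_AndE2; now apply D_pre_snoc |].
    now apply nd_OrI2.
Qed.

Lemma numeral_pre_intro (u v : list bool) :
  nd Gamma (numeral u ⪯ numeral (u ++ v)).
Proof. unfold numeral; rewrite rev_app_distr; apply rev_numeral_pre_intro. Qed.

(** If [b = e], then [c b = c e = c = e c] for the opposite bit [c]. *)
Lemma bit_neq_eps (b : bool) : nd Gamma (bit b ≭ Eps).
Proof.
  apply nd_modus_tollens with (bit (negb b) ∘ bit b ≐ Eps ∘ bit (negb b));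
    [|now apply D_last_bit].
  assert (HD' : incl D_axioms ((bit b ≐ Eps) :: Gamma)) by now apply incl_tl.
  eapply nd_eq_trans; [apply nd_conc_cong; [apply nd_refl | apply nd_hyp] |].
  eapply nd_eq_trans; [now apply nd_eq_sym, D_unit_r | now apply D_unit_l].
Qed.

(** Here the prefix axioms enter: [x ⪯ xb] turns [xb = e] into [x = e]. *)
Lemma rev_numeral_cons_neq_eps (b : bool) (l : list bool) :
  nd Gamma (rev_numeral (b :: l) ≭ Eps).
Proof.
  apply nd_modus_tollens with (bit b ≐ Eps); [|apply bit_neq_eps].
  set (Delta := _ :: Gamma).
  assert (HD' : incl D_axioms Delta) by now apply incl_tl.
  assert (Hnil : nd Delta (rev_numeral l ≐ Eps)).
  { eapply nd_ImpE; [eapply nd_AndE1; now apply D_pre_eps |].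
    eapply nd_pre_cong; [apply nd_refl | apply nd_hyp |].
    apply (nd_weaken Gamma); [apply (rev_numeral_pre_intro [b]) |].
    apply incl_tl, incl_refl. }
  apply nd_eq_trans with (rev_numeral l ∘ bit b); [|apply nd_hyp].
  eapply nd_eq_trans; [now apply D_unit_l |].
  apply nd_conc_cong; [now apply nd_eq_sym | apply nd_refl].
Qed.

Lemma rev_numeral_neq (k : list bool) : forall l : list bool,
  k <> l -> nd Gamma (rev_numeral k ≭ rev_numeral l).
Proof.
  induction k as [|b k IH]; intros [|c l] H.
  - now destruct H.
  - eapply nd_modus_tollens;
      [apply nd_eq_sym, nd_hyp | apply rev_numeral_cons_neq_eps].
  - apply rev_numeral_cons_neq_eps.
  - simpl. destruct (bool_dec b c) as [<-|Hbc].
    + apply D_snoc_inj; trivial. apply IH. congruence.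
    + replace c with (negb b) by (destruct b, c; simpl; congruence).
      now apply D_last_bit.
Qed.

Lemma numeral_neq (u v : list bool) :
  u <> v -> nd Gamma (numeral u ≭ numeral v).
Proof.
  intros H; apply rev_numeral_neq; intros E; apply H.
  now rewrite <- (rev_involutive u), E, rev_involutive.
Qed.

End Numerals.

(** The disjunction over the prefixes of a numeral is stated as an elimination
    rule, which avoids building it as a formula. *)
Lemma rev_numeral_pre_elim (x : term) (C : form) (l : list bool) :
  forall Gamma, incl D_axioms Gamma ->
  nd Gamma (x ⪯ rev_numeral l) ->
  (forall k p, k ++ p = l -> nd ((x ≐ rev_numeral p) :: Gamma) C) ->
  nd Gamma C.
Proof.
  induction l as [|b l IH]; simpl; intros Gamma HD Hx HC.
  - eapply nd_ImpE; [apply nd_ImpI, (HC [] []); reflexivity |].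
    eapply nd_ImpE; [eapply nd_AndE1; now apply D_pre_eps | exact Hx].
  - eapply nd_OrE.
    + eapply nd_ImpE; [eapply nd_AndE1; now apply D_pre_snoc | exact Hx].
    + apply (HC [] (b :: l)); reflexivity.
    + apply IH; [now apply incl_tl | apply nd_hyp |].
      intros k p E. apply nd_weaken with ((x ≐ rev_numeral p) :: Gamma).
      * apply (HC (b :: k)); simpl; congruence.
      * apply incl_cons; [now left | now apply incl_tl, incl_tl, incl_refl].
Qed.

Lemma numeral_pre_elim (Gamma : list form) (x : term) (w : list bool) (C : form) :
  incl D_axioms Gamma ->
  nd Gamma (x ⪯ numeral w) ->
  (forall u v, u ++ v = w -> nd ((x ≐ numeral u) :: Gamma) C) ->
  nd Gamma C.
Proof.
  intros HD Hx HC. apply (rev_numeral_pre_elim x C (rev w) Gamma HD Hx).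
  intros k p E. rewrite <- (rev_involutive p).
  apply (HC (rev p) (rev k)).
  now rewrite <- rev_app_distr, E, rev_involutive.
Qed.

(** * Completeness for Sigma-formulas *)

Definition numerals (rho : nat -> bit_strings) (n : nat) : term :=
  numeral (rho n).

Lemma up_numerals (rho : nat -> bit_strings) (n : nat) :
  up (numerals rho) n = scons (Var 0) (numerals rho) n.
Proof. destruct n; [reflexivity | apply subst_rev_numeral]. Qed.

Lemma inst_up_numerals (rho : nat -> bit_strings) (t : term) (A : form) :
  inst t (subst (up (numerals rho)) A) = subst (scons t (numerals rho)) A.
Proof.
  unfold inst; rewrite subst_comp; apply subst_ext; intros n.
  rewrite up_numerals. destruct n; [reflexivity | apply subst_rev_numeral].
Qed.

Lemma inst_numeral (rho : nat -> bit_strings) (d : list bool) (A : form) :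
  inst (numeral d) (subst (up (numerals rho)) A)
  = subst (numerals (scons d rho)) A.
Proof. rewrite inst_up_numerals; apply subst_ext; now intros [|n]. Qed.

Lemma inst_Var0 (rho : nat -> bit_strings) (A : form) :
  inst (Var 0) (subst (up (numerals rho)) A) = subst (up (numerals rho)) A.
Proof.
  rewrite inst_up_numerals; apply subst_ext; intros n; now rewrite up_numerals.
Qed.

Lemma up_numerals_shift_term (rho : nat -> bit_strings) (t : term) :
  subst_term (up (numerals rho)) (shift_term t) = subst_term (numerals rho) t.
Proof.
  unfold shift_term; rewrite subst_term_comp; apply subst_term_ext.
  intros n; exact (up_numerals rho (S n)).
Qed.

Lemma eval_shift_term (rho : nat -> bit_strings) (d : bit_strings) (t : term) :
  eval bit_strings (scons d rho) (shift_term t) = eval bit_strings rho t.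
Proof. unfold shift_term; induction t; simpl in *; congruence. Qed.

Lemma eval_numeral (Gamma : list form) (rho : nat -> bit_strings) (t : term) :
  incl D_axioms Gamma ->
  nd Gamma (subst_term (numerals rho) t ≐ numeral (eval bit_strings rho t)).
Proof.
  intros HD; induction t; simpl.
  - apply nd_refl.
  - apply nd_refl.
  - exact (D_unit_l Gamma HD Zero).
  - exact (D_unit_l Gamma HD One).
  - eapply nd_eq_trans; [apply nd_conc_cong; eassumption |].
    now apply numeral_conc.
Qed.

Lemma pre_complete (rho : nat -> bit_strings) (s t : term) :
  sat bit_strings rho (s ⪯ t) -> nd D_axioms (subst (numerals rho) (s ⪯ t)).
Proof.
  intros [x E]; simpl.
  eapply nd_pre_cong; [apply nd_eq_sym, eval_numeral, incl_refl
                      | apply nd_eq_sym, eval_numeral, incl_refl |].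
  rewrite <- E. apply numeral_pre_intro, incl_refl.
Qed.

Lemma Sigma_complete (A : form) : Sigma A ->
  forall rho : nat -> bit_strings,
  sat bit_strings rho A -> nd D_axioms (subst (numerals rho) A).
Proof.
  pose proof (incl_refl D_axioms) as HD.
  induction 1 as [s t|s t|s t|s t|A B _ IHA _ IHB|A B _ IHA _ IHB
                 |t A _ IHA|t A _ IHA|A _ IHA]; intros rho Hsat.
  - simpl in *. eapply nd_eq_trans; [now apply eval_numeral |].
    rewrite Hsat. now apply nd_eq_sym, eval_numeral.
  - simpl in *.
    apply nd_modus_tollens with
      (numeral (eval bit_strings rho s) ≐ numeral (eval bit_strings rho t));
      [|now apply numeral_neq].
    eapply nd_eq_trans;
      [apply nd_eq_sym, eval_numeral; now apply incl_tl |].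
    eapply nd_eq_trans; [apply nd_hyp |].
    apply eval_numeral; now apply incl_tl.
  - now apply pre_complete.
  - simpl in *.
    (* the contradiction is derived case by case over the prefixes of [t] *)
    apply nd_NegI with (Eps ≭ Eps); [|
      eapply nd_NegI; [apply nd_refl | apply nd_hyp]].
    set (Delta := _ :: D_axioms).
    assert (HD' : incl D_axioms Delta) by now apply incl_tl.
    apply (numeral_pre_elim Delta (numeral (eval bit_strings rho s))
             (eval bit_strings rho t)); trivial.
    + eapply nd_pre_cong; [now apply eval_numeral | now apply eval_numeral |].
      apply nd_hyp.
    + intros u v E. eapply nd_NegE; [apply nd_hyp |].
      apply numeral_neq; [now apply incl_tl |].
      intros <-; apply Hsat; now exists v.
  - destruct Hsat; simpl; [apply nd_OrI1 | apply nd_OrI2]; auto.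
  - destruct Hsat; simpl; apply nd_AndI; auto.
  - destruct Hsat as [d [Hpre HA]].
    change (nd D_axioms (Ex (subst (up (numerals rho))
              (Var 0 ⪯ shift_term t ∧' A)))).
    apply nd_ExI with (numeral d). rewrite inst_numeral.
    apply nd_AndI; [now apply (pre_complete _ (Var 0)) | now apply IHA].
  - simpl in *. apply nd_AllI.
    (* the axioms are closed *)
    change (map shift D_axioms) with D_axioms.
    apply nd_ImpI. rewrite up_numerals_shift_term.
    set (Delta := _ :: D_axioms).
    assert (HD' : incl D_axioms Delta) by now apply incl_tl.
    apply (numeral_pre_elim Delta (Var 0) (eval bit_strings rho t)); trivial.
    + eapply nd_pre_cong; [apply nd_refl | now apply eval_numeral | apply nd_hyp].
    + intros u v E. rewrite <- inst_Var0.
      eapply nd_subst; [apply nd_eq_sym, nd_hyp |].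
      rewrite inst_numeral. apply nd_weaken with D_axioms; [|now apply incl_tl].
      apply IHA, Hsat. exists v. now rewrite eval_shift_term.
  - destruct Hsat as [d Hd]. apply nd_ExI with (numeral d).
    rewrite inst_numeral. now apply IHA.
Qed.

Theorem theorem4 (phi : form) (hphi : Sigma_sentence phi) :
  models bit_strings phi -> proves D phi.
Proof.
  intros Hphi. destruct hphi as [HS Hclosed].
  exists D_axioms. split; [trivial |].
  pose proof (Sigma_complete phi HS (fun _ => []) (Hphi _)) as K.
  rewrite subst_free_id in K; [exact K |].
  intros k Hk; now destruct (Hclosed k).
Qed.
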